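(* If $R$ is a $6$-centralizer finite ring such that $\frac{R}{Z(R)}$ is isomorphic neither to $\mathbb{Z}_2 \times \mathbb{Z}_2 \times \mathbb{Z}_4$ nor to $\mathbb{Z}_2 \times \mathbb{Z}_2 \times \mathbb{Z}_2 \times \mathbb{Z}_2$, then $\Pr(R) \in \left\{\frac{7}{16}, \frac{35}{72}, \frac{29}{64}\right\}$.
   Context: Rings are associative; no identity element is assumed. For a finite ring $R$ and $x \in R$, the centralizer of $x$ is $C_R(x) = \{s \in R : xs = sx\}$, and the center is $Z(R) = \bigcap_{x \in R} C_R(x)$. Put $\operatorname{Cent}(R) = \{C_R(x) : x \in R\}$; $R$ is called $n$-centralizer if $|\operatorname{Cent}(R)| = n$. The commuting probability of $R$ is $\Pr(R) = \frac{|\{(r,s) \in R \times R : rs = sr\}|}{|R|^2}$. $\frac{R}{Z(R)}$ denotes the quotient of the additive group $(R,+)$ by its subgroup $(Z(R),+)$, and isomorphisms are isomorphisms of additive groups. $\mathbb{Z}_m$ is the cyclic group of order $m$. *)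

(* Defs.v *)
From HB Require Import structures.
From mathcomp Require Import all_boot all_order all_algebra all_fingroup.

Set Implicit Arguments.
Unset Strict Implicit.
Unset Printing Implicit Defensive.

Import GRing.Theory.
Local Open Scope ring_scope.

(* Associative rings without an assumed identity: MathComp's [pzRingType]
   already has a unit, so the multiplication is added to a [zmodType]. *)
HB.mixin Record Zmodule_isRng R of GRing.Zmodule R := {
  rngmul : R -> R -> R;
  rngmulA : associative rngmul;
  rngmulDl : left_distributive rngmul +%R;
  rngmulDr : right_distributive rngmul +%R
}.

#[short(type="finRngType")]
HB.structure Definition FinRng := {R of FinRing.Zmodule R & Zmodule_isRng R}.

(* As for the structures of finalg, the [finGroupType] structure of a finite
   rng is its additive group. *)
HB.instance Definition _ (R : FinRng.type) := [finGroupMixin of R for +%R].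
Coercion FinRng_to_baseFinGroup (R : FinRng.type) := FinStarMonoid.clone R _.
Coercion FinRng_to_finGroup (R : FinRng.type) := FinGroup.clone R _.

Section Centralizers.
Variable R : finRngType.
Implicit Type x y : R.

Definition rng_centralizer x : {set R} := [set s | rngmul x s == rngmul s x].

Definition rng_center : {set R} := \bigcap_(x : R) rng_centralizer x.

Definition rng_Cent : {set {set R}} := [set rng_centralizer x | x : R].

Definition commuting_pr : rat :=
  #|[set rs : R * R | rngmul rs.1 rs.2 == rngmul rs.2 rs.1]|%:R / #|R|%:R ^+ 2.

Lemma rng_center_group_set : group_set rng_center.
Proof.
have mul0 x : rngmul x 0 = 0.
  by apply: (addIr (rngmul x 0)); rewrite -rngmulDr !add0r.
have mul0l x : rngmul 0 x = 0.
  by apply: (addIr (rngmul 0 x)); rewrite -rngmulDl !add0r.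
apply/group_setP; split=> [|s t /bigcapP zs /bigcapP zt].
  by apply/bigcapP => x _; rewrite inE FinRing.zmod1gE mul0 mul0l.
apply/bigcapP => x _; move: (zs x isT) (zt x isT); rewrite !inE.
by rewrite FinRing.zmodMgE rngmulDr rngmulDl => /eqP-> /eqP->.
Qed.

Canonical rng_center_group : {group R} := Group rng_center_group_set.

End Centralizers.

Definition n_centralizer (R : finRngType) (n : nat) : Prop := #|rng_Cent R| = n.

(* Main.v *)
(* Write [x; y] = xy - yx, a biadditive alternating map whose radical is Z = Z(R),
   and let there be five proper centralizers. Finding a seventh centralizer in
   each forbidden configuration shows that C(x) and C(y) meet in Z whenever
   [x; y] <> 0, so that the five proper centralizers are commutative and
   partition R \ Z, and that 2[x; y] = 0 or 3[x; y] = 0, so that R/Z is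
   elementary abelian of exponent p = 2 or 3. If A = C(x) is proper and y is not
   in A, then for a in A the centralizer C(y + a) differs from A and determines a
   modulo Z, whence |A/Z| <= 4. For p = 3 this forces |R/Z| = 1 + 5 * 2,
   which is not a power of 3. For p = 2, if k of the five quotients A/Z have order
   4 then |R/Z| = 6 + 2k is a power of 2, so k = 5 and R/Z is Z_2^4, or k = 1,
   |R/Z| = 8 and Pr(R) = (8 + 3 * 4 + 4 * 2) / 64 = 7/16. *)
Require Import Defs.
From mathcomp Require Import all_boot all_order all_algebra all_fingroup all_solvable.
From mathcomp Require Import zify ring.

Set Implicit Arguments.
Unset Strict Implicit.
Unset Printing Implicit Defensive.

Import GRing.Theory Num.Theory.

Section Commutators.
Local Open Scope ring_scope.
Variable R : finRngType.
Implicit Types (x y z w u v : R) (s t : seq R) (A : {set R}).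

Local Notation C := (@rng_centralizer R).
Local Notation Z := (rng_center R).

(** * Additive commutators and centralizers *)

Definition rng_comm x y : R := rngmul x y - rngmul y x.
Local Notation "[ x ; y ]" := (rng_comm x y) (at level 0).

Lemma rng_commDl x y z : [x + y; z] = [x; z] + [y; z].
Proof. by rewrite /rng_comm rngmulDl rngmulDr opprD addrACA. Qed.

Lemma rng_commC x y : [y; x] = - [x; y].
Proof. by rewrite /rng_comm opprB. Qed.

Lemma rng_commDr x y z : [z; x + y] = [z; x] + [z; y].
Proof. by rewrite rng_commC rng_commDl opprD -!rng_commC. Qed.

Lemma rng_comm_self x : [x; x] = 0.
Proof. exact: subrr. Qed.

Lemma rng_comm0l x : [0; x] = 0.
Proof. by apply: (addIr [0; x]); rewrite -rng_commDl !add0r. Qed.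

Lemma rng_comm0r x : [x; 0] = 0.
Proof. by rewrite rng_commC rng_comm0l oppr0. Qed.

Lemma rng_commNr x y : [x; - y] = - [x; y].
Proof. by apply: (addrI [x; y]); rewrite -rng_commDr !subrr rng_comm0r. Qed.

Lemma rng_commMnr x y n : [x; y *+ n] = [x; y] *+ n.
Proof.
by elim: n => [|n IHn]; rewrite ?mulr0n ?rng_comm0r // !mulrS rng_commDr IHn.
Qed.

Lemma rng_commMnl x y n : [x *+ n; y] = [x; y] *+ n.
Proof. by rewrite rng_commC rng_commMnr -mulNrn -rng_commC. Qed.

Lemma rng_commMzr x y (n : int) : [x; y *~ n] = [x; y] *~ n.
Proof.
by case: n => n; rewrite ?NegzE ?mulrNz ?rng_commNr -!pmulrn rng_commMnr.
Qed.

Lemma rng_commMzl x y (n : int) : [x *~ n; y] = [x; y] *~ n.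
Proof. by rewrite rng_commC rng_commMzr -mulNrz -rng_commC. Qed.

Lemma mem_centralizer x y : (y \in C x) = ([x; y] == 0).
Proof. by rewrite inE -subr_eq0. Qed.

Lemma rng_comm_eq0C x y : ([x; y] == 0) = ([y; x] == 0).
Proof. by rewrite rng_commC oppr_eq0. Qed.

Lemma mem_center z : (z \in Z) = [forall x, [x; z] == 0].
Proof.
apply/bigcapP/forallP => [zZ x | zZ x _]; last by rewrite mem_centralizer.
by rewrite -mem_centralizer zZ.
Qed.

Lemma centerP z : reflect (forall x, [x; z] = 0) (z \in Z).
Proof. by rewrite mem_center; apply: (iffP forallP) => zZ x; apply/eqP. Qed.

Lemma notin_centerP z : reflect (exists x, [x; z] != 0) (z \notin Z).
Proof.
rewrite mem_center negb_forall.
by apply: (iffP existsP) => -[x xz]; exists x.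
Qed.

Lemma center_sub_centralizer x : Z \subset C x.
Proof. exact: bigcap_inf. Qed.

Lemma centralizer_eqT x : (C x == [set: R]) = (x \in Z).
Proof.
rewrite mem_center; apply/eqP/forallP => [CxT y | xZ].
  by rewrite rng_comm_eq0C -mem_centralizer CxT inE.
by apply/setP => y; rewrite mem_centralizer rng_comm_eq0C xZ inE.
Qed.

Lemma centralizer_group_set x : group_set (C x).
Proof.
apply/group_setP; split=> [|y z].
  by rewrite FinRing.zmod1gE mem_centralizer rng_comm0r.
rewrite !mem_centralizer FinRing.zmodMgE rng_commDr => /eqP-> /eqP->.
by rewrite addr0.
Qed.

Canonical centralizer_group x : {group R} := Group (centralizer_group_set x).

(* The entries of the matrix decide which of the test elements [t] lie in the
   centralizer of each element of [s], so distinct rows separate centralizers. *)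
Lemma uniq_centralizers s t :
  uniq [seq [seq [u; v] == 0 | v <- t] | u <- s] -> (size s <= #|rng_Cent R|)%N.
Proof.
move=> us; rewrite -(size_map C) cardE; apply: uniq_leq_size => [|A /mapP[u _ ->]].
  apply: (@map_uniq _ _ (fun A => [seq v \in A | v <- t])).
  rewrite -map_comp; congr uniq: us; apply: eq_map => u; apply: eq_map => v /=.
  by rewrite mem_centralizer.
by rewrite mem_enum imset_f.
Qed.

(** * Intersections of centralizers *)

Hypothesis R6 : n_centralizer R 6.

(** If [x; w] were nonzero, [x + w] would supply a seventh centralizer. *)
Lemma rng_comm_eq0_of_common_centralizer x y z w :
  [x; y] != 0 -> [x; z] = 0 -> [y; z] = 0 -> [z; w] != 0 -> [x; w] = 0.
Proof.
move=> xy xz yz zw; apply/eqP; apply: contraT => xw.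
have := @uniq_centralizers [:: 0; x; y; x + y; z; w; x + w] [:: x; y; z; w].
rewrite /= R6 !rng_commDl !rng_comm0l !rng_comm_self xz yz.
rewrite [[z; x]]rng_commC [[z; y]]rng_commC [[w; z]]rng_commC [[y; x]]rng_commC.
rewrite [[w; x]]rng_commC [[w; y]]rng_commC xz yz !(oppr0, addr0, add0r, oppr_eq0).
rewrite !eqxx (negbTE xy) (negbTE zw) (negbTE xw).
(* Only entries involving [y; w] are still undecided; the seven rows are distinct whatever their
   values. *)
by do ![case: (_ == 0)] => /(_ isT).
Qed.

(** A noncentral z moves some w; by the preceding lemma, used for x and for y, this w commutes with
    both, and then [x + z] has a seventh centralizer. *)
Lemma centralizerI_noncommuting x y z :
  [x; y] != 0 -> [x; z] = 0 -> [y; z] = 0 -> z \in Z.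
Proof.
move=> xy xz yz; apply: contraT => /notin_centerP[w wz].
have zw : [z; w] != 0 by rewrite -rng_comm_eq0C.
have xw := rng_comm_eq0_of_common_centralizer xy xz yz zw.
have yx : [y; x] != 0 by rewrite -rng_comm_eq0C.
have yw := rng_comm_eq0_of_common_centralizer yx yz xz zw.
have := @uniq_centralizers [:: 0; x; y; x + y; z; w; x + z] [:: x; y; z; w].
rewrite /= R6 !rng_commDl !rng_comm0l !rng_comm_self xz yz xw yw.
rewrite [[z; x]]rng_commC [[z; y]]rng_commC [[w; z]]rng_commC [[y; x]]rng_commC.
rewrite [[w; x]]rng_commC [[w; y]]rng_commC xz yz xw yw.
rewrite !(oppr0, addr0, add0r, oppr_eq0) !eqxx (negbTE xy) (negbTE zw).
by move=> /(_ isT).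
Qed.

(** If v and w did not commute, u would lie in both their centralizers and hence be central. So
    proper centralizers are commutative. *)
Lemma rng_comm_trans u v w :
  u \notin Z -> [u; v] = 0 -> [u; w] = 0 -> [v; w] = 0.
Proof.
move=> uZ uv uw; apply/eqP; apply: contraNT uZ => vw.
by apply: centralizerI_noncommuting vw _ _; rewrite rng_commC (uv, uw) oppr0.
Qed.

(** * The exponent of R/Z *)

(** A single commutator decides: px and py commute with x and y, so they are central; then [x; pw] =
    [px; w] = 0 and likewise for y, so pw is central. *)
Lemma mulrn_center x y p :
  [x; y] != 0 -> [x; y] *+ p = 0 -> forall w, w *+ p \in Z.
Proof.
move=> xy xyp.
have yx : [y; x] != 0 by rewrite -rng_comm_eq0C.
have xp : x *+ p \in Z.
  apply: centralizerI_noncommuting xy _ _; first by rewrite rng_commMnr rng_comm_self mul0rn.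
  by rewrite rng_commMnr rng_commC mulNrn xyp oppr0.
have yp : y *+ p \in Z.
  apply: centralizerI_noncommuting xy _ _; first by rewrite rng_commMnr xyp.
  by rewrite rng_commMnr rng_comm_self mul0rn.
have killed u w : u *+ p \in Z -> [u; w *+ p] = 0.
  by move/centerP=> uZ; rewrite rng_commMnr -rng_commMnl rng_commC uZ oppr0.
move=> w.
exact: centralizerI_noncommuting xy (killed x w xp) (killed y w yp).
Qed.

Lemma rng_comm_exponent x y : [x; y] != 0 -> ([x; y] *+ 2 == 0) || ([x; y] *+ 3 == 0).
Proof.
move=> xy; apply: contraT; rewrite negb_or => /andP[c2 c3].
pose f (p : int * int) := x *~ p.1 + y *~ p.2.
(* By biadditivity, two integer combinations of x and y have as commutator their determinant times
   [x; y]. *)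
pose det (p q : int * int) := p.1 * q.2 - p.2 * q.1.
have fE p q : [f p; f q] = [x; y] *~ det p q.
  rewrite /f rng_commDl !rng_commDr !rng_commMzl !rng_commMzr !rng_comm_self.
  rewrite !mul0rz add0r addr0 [[y; x]]rng_commC mulNrz mulNrz /det mulrzBr.
by rewrite [p.1 * _]mulrC [p.2 * _]mulrC !mulrzA.
(* Six elements that pairwise do not commute if 2[x; y] and 3[x; y] are nonzero. *)
pose L : seq (int * int) := [:: (1, 0); (0, 1); (1, 1); (1, -1); (2, 1); (1, 2)].
(* The determinants that occur have absolute value at most 3, so [xy], [c2] and [c3] let such a
   multiple of [x; y] vanish only for determinant 0. *)
have nz n : n \in [:: 0; 1; -1; 2; -2; 3; -3] -> ([x; y] *~ n == 0) = (n == 0).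
  by rewrite !inE; do ![case/predU1P=> [-> |]]; last move/eqP->;
     rewrite ?mulr0z ?mulrNz ?oppr_eq0 ?eqxx ?mulr1z ?(negbTE xy) ?(negbTE c2) ?(negbTE c3).
have detL : {in (0, 0) :: L & L, forall p q, det p q \in [:: 0; 1; -1; 2; -2; 3; -3]}.
  by apply/allrelP.
rewrite -[false]/(7 <= 6)%N -[X in (_ <= X)%N]R6.
apply: (@uniq_centralizers (map f ((0, 0) :: L)) (map f L)).
rewrite -map_comp.
rewrite (_ : map _ _ = [seq [seq det p q == 0 | q <- L] | p <- (0, 0) :: L]) //.
apply/eq_in_map => p pL.
rewrite [LHS](_ : _ = [seq [f p; f q] == 0 | q <- L]) //.
by apply/eq_in_map => q qL; rewrite fE nz ?detL.
Qed.

Lemma exists_noncommuting : exists x y, [x; y] != 0.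
Proof.
case: (pickP [pred x | x \notin Z]) => [x /notin_centerP[y yx] | Z1]; first by exists y, x.
have : (#|rng_Cent R| <= 1)%N.
  rewrite -(cards1 [set: R]); apply: subset_leq_card; apply/subsetP => A /imsetP[x _ ->].
  by rewrite inE centralizer_eqT; apply: negbFE; apply: Z1.
by rewrite R6.
Qed.

Lemma center_exponent : exists2 p, p = 2%N \/ p = 3%N & forall w, w *+ p \in Z.
Proof.
have [x [y xy]] := exists_noncommuting.
case/orP: (rng_comm_exponent xy) => /eqP; [exists 2%N | exists 3%N]; eauto using mulrn_center.
Qed.

Lemma quotient_center_abelem (H : {group R}) p :
  prime p -> (forall w, w *+ p \in Z) -> (p.-abelem (H / Z))%g.
Proof.
move=> p_pr pZ; apply/abelemP => //; split; first exact/quotient_abelian/FinRing.zmod_abelian.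
move=> _ /morphimP[x xN _ ->].
by rewrite -morphX //= FinRing.zmodXgE coset_id.
Qed.

Lemma card_quotient_center (H : {group R}) :
  Z \subset H -> #|H| = (#|(H / Z)%g| * #|Z|)%N.
Proof.
move=> ZH; have nZ : H \subset 'N(Z)%g by apply: sub_abelian_norm ZH; apply: FinRing.zmod_abelian.
by rewrite (card_quotient nZ) mulnC -(Lagrange ZH).
Qed.

Lemma card_center_exponent (H : {group R}) p :
  prime p -> (forall w, w *+ p \in Z) -> Z \subset H ->
  exists m, #|H| = (p ^ m * #|Z|)%N.
Proof.
move=> p_pr pZ ZH; exists (logn p #|(H / Z)%g|).
have HZ : (p.-group (H / Z))%g by apply/abelem_pgroup/quotient_center_abelem.
by rewrite -(card_pgroup HZ) -(card_quotient_center ZH).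
Qed.

(** * The partition by proper centralizers *)

Local Notation K := (rng_Cent R :\ [set: R]).

Lemma card_proper_centralizers : #|K| = 5%N.
Proof.
have TC : [set: R] \in rng_Cent R.
  by apply/imsetP; exists 0 => //; apply/esym/eqP; rewrite centralizer_eqT group1.
by have := cardsD1 [set: R] (rng_Cent R); rewrite TC R6 => -[].
Qed.

Lemma proper_centralizer u : (C u \in K) = (u \notin Z).
Proof. by rewrite in_setD1 imset_f // andbT centralizer_eqT. Qed.

Lemma proper_centralizerP A : reflect (exists2 x, x \notin Z & A = C x) (A \in K).
Proof.
apply: (iffP idP) => [AK | [x xZ ->]]; last by rewrite proper_centralizer.
case/setD1P: (AK) => _ /imsetP[x _ Ax]; exists x => //.
by rewrite -proper_centralizer -Ax.
Qed.

(** By transitivity of commuting, the fibres of [C] on noncentral elements are the sets A minus Z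
    with A a proper centralizer; these therefore partition R minus Z. *)
Lemma proper_centralizer_class x u :
  x \notin Z -> (u \notin Z) && (C u == C x) = (u \in C x :\: Z).
Proof.
move=> xZ; rewrite in_setD; case: (boolP (u \in Z)) => //= uZ; apply/eqP/idP => [<-|].
  by rewrite mem_centralizer rng_comm_self.
rewrite mem_centralizer => /eqP xu; have ux : [u; x] = 0 by rewrite rng_commC xu oppr0.
apply/setP => w; rewrite !mem_centralizer.
by apply/eqP/eqP; [apply: rng_comm_trans uZ ux | apply: rng_comm_trans xZ xu].
Qed.

(** Taken with [F] constantly 1 it counts R; with [F] the cardinality it counts commuting pairs. *)
Lemma sum_noncentral (F : {set R} -> nat) :
  (\sum_(u | u \notin Z) F (C u) = \sum_(A in K) (#|A| - #|Z|) * F A)%N.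
Proof.
rewrite (partition_big C (fun A => A \in K)) => [|u]; last by rewrite proper_centralizer.
apply: eq_bigr => _ /proper_centralizerP[x xZ ->].
rewrite (eq_bigr (fun=> F (C x))) => [|u /andP[_ /eqP->] //].
rewrite (eq_bigl _ _ (fun u => proper_centralizer_class u xZ)) sum_nat_const.
by rewrite cardsD (setIidPr (center_sub_centralizer x)).
Qed.

Lemma card_proper_centralizer_le A : A \in K -> (#|A| <= 4 * #|Z|)%N.
Proof.
move=> AK; case/proper_centralizerP: (AK) => x xZ Ax.
have [y yx] := notin_centerP _ xZ.
(* Since x does not commute with y + a, the map from a to C(y + a) lands in the four other proper
   centralizers; each fibre turns out to have at most |Z| elements. *)
have yA a : a \in A -> C (y + a) \in K :\ A.
  rewrite Ax mem_centralizer => /eqP xa; have xya : [x; y + a] != 0.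
    by rewrite rng_commDr xa addr0 -rng_comm_eq0C.
  rewrite in_setD1 proper_centralizer; apply/andP; split; last by apply/notin_centerP; exists x.
  apply: contraNneq xya => CE.
  by rewrite rng_comm_eq0C -mem_centralizer CE mem_centralizer rng_comm_self.
have -> : 4%N = #|K :\ A| by have := cardsD1 A K; rewrite card_proper_centralizers AK => -[].
rewrite -sum1_card (partition_big (fun a => C (y + a)) _ yA) /=.
rewrite -sum_nat_const; apply: leq_sum => B _.
rewrite sum1dep_card.
have [-> | [a]] := set_0Vmem [set a in A | C (y + a) == B]; first by rewrite cards0.
rewrite inE => /andP[aA /eqP aB].
(* The fibre through a is contained in the coset a + Z. *)
rewrite -(card_imset (mem Z) (@addrI _ a)); apply: subset_leq_card; apply/subsetP => b.
rewrite inE => /andP[bA /eqP bB]; apply/imsetP; exists (b - a); last by rewrite addrC subrK.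
move: aA bA; rewrite Ax !mem_centralizer => /eqP xa /eqP xb.
have ab : [a; b] = 0 by apply: rng_comm_trans xZ xa xb.
(* This commutator equals [y; b - a], because a and b commute. So b - a commutes with both y and x,
   and is central. *)
have : [y + a; y + b] == 0.
  by rewrite -mem_centralizer aB -bB mem_centralizer rng_comm_self.
rewrite rng_commDl !rng_commDr rng_comm_self ab add0r addr0 [[a; y]]rng_commC => yab.
apply: centralizerI_noncommuting yx _ _; rewrite rng_commDr rng_commNr.
  exact/eqP.
by rewrite xa xb subr0.
Qed.

Lemma card_proper_centralizer_gt A : A \in K -> (#|Z| < #|A|)%N.
Proof.
case/proper_centralizerP=> x xZ ->; apply: proper_card; apply/properP; split.
  exact: center_sub_centralizer.
by exists x; rewrite // mem_centralizer rng_comm_self.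
Qed.

(** * Counting elements and commuting pairs *)

Lemma card_rng_centralizers :
  #|R| = (#|Z| + \sum_(A in K) (#|A| - #|Z|))%N.
Proof.
rewrite -(cardsC Z); congr addn; rewrite -sum1_card.
rewrite (eq_bigl (fun u => u \notin Z)) => [|u]; last by rewrite inE.
by rewrite (sum_noncentral (fun=> 1%N)); apply: eq_bigr => A _; rewrite muln1.
Qed.

Lemma card_commuting_pairs :
  #|[set rs : R * R | rngmul rs.1 rs.2 == rngmul rs.2 rs.1]|
    = (#|Z| * #|R| + \sum_(A in K) (#|A| - #|Z|) * #|A|)%N.
Proof.
rewrite -sum1dep_card.
rewrite -(pair_big_dep predT (fun u v => rngmul u v == rngmul v u) (fun _ _ => 1%N)) /=.
rewrite (eq_bigr (fun u => #|C u|)) => [|u _]; last by rewrite sum1dep_card.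
rewrite (bigID (mem Z)) (sum_noncentral (fun A => #|A|)) /=; congr addn.
rewrite (eq_bigr (fun=> #|R|)) ?sum_nat_const // => u.
by rewrite -centralizer_eqT => /eqP->; rewrite cardsT.
Qed.

Lemma card_rng_exponent3 : ~ forall w, w *+ 3 \in Z.
Proof.
move=> Z3; have z_gt0 : (0 < #|Z|)%N by apply: cardG_gt0.
(* The only power of 3 above 1 and at most 4 is 3 itself. *)
have cardK A : A \in K -> (#|A| - #|Z| = 2 * #|Z|)%N.
  move=> AK; have := card_proper_centralizer_gt AK; have := card_proper_centralizer_le AK.
  case/proper_centralizerP: AK => x _ ->.
  have [//|//|[|[|m]] ->] := @card_center_exponent (centralizer_group x) 3 _ Z3 _.
  - exact: center_sub_centralizer.
  - by rewrite mul1n ltnn.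
  - by move=> _ _; rewrite expn1; lia.
  by rewrite leq_pmul2r // !expnS => h; exfalso; have := expn_gt0 3 m; lia.
have [m Em] := @card_center_exponent [set: R]%G 3 isT Z3 (subsetT _).
have := card_rng_centralizers; rewrite (eq_bigr _ cardK) sum_nat_const card_proper_centralizers.
rewrite -cardsT Em => E.
have {E} : (3 ^ m = 11)%N by apply/eqP; rewrite -(eqn_pmul2r z_gt0) E; apply/eqP; lia.
by case: m {Em} => [|[|[|m]]] //; rewrite !expnS => h; have := expn_gt0 3 m; lia.
Qed.

Lemma card_rng_exponent2 : (forall w, w *+ 2 \in Z) ->
  #|R| = (16 * #|Z|)%N \/
  #|R| = (8 * #|Z|)%N /\
    #|[set rs : R * R | rngmul rs.1 rs.2 == rngmul rs.2 rs.1]| = (28 * #|Z| ^ 2)%N.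
Proof.
move=> Z2; have z_gt0 : (0 < #|Z|)%N by apply: cardG_gt0.
(* [b A] marks whether A/Z has order 4 rather than 2, and is used below as a number. *)
pose b A := (#|A| == 4 * #|Z|)%N.
have cardK A : A \in K -> (#|A| = (2 + 2 * b A) * #|Z|)%N.
  rewrite /b => AK; have := card_proper_centralizer_gt AK.
  have := card_proper_centralizer_le AK.
  case/proper_centralizerP: AK => x _ ->.
  have [//|//|[|[|[|m]]] ->] := @card_center_exponent (centralizer_group x) 2 _ Z2 _.
  - exact: center_sub_centralizer.
  - by rewrite mul1n ltnn.
  - by move=> _ _; rewrite expn1 eqn_pmul2r.
  - by move=> _ _; rewrite eqxx.
  by rewrite leq_pmul2r // !expnS => h; exfalso; have := expn_gt0 2 m; lia.
pose k := (\sum_(A in K) b A)%N.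
have k5 : (k <= 5)%N.
  by rewrite -card_proper_centralizers -sum1_card; apply: leq_sum => A _; case: (b A).
have cardR : #|R| = ((6 + 2 * k) * #|Z|)%N.
  rewrite card_rng_centralizers (eq_bigr (fun A => #|Z| + 2 * #|Z| * b A)%N).
    by rewrite big_split /= sum_nat_const -big_distrr /= card_proper_centralizers -/k; lia.
  by move=> A /cardK ->; case: (b A); lia.
have [m Em] := @card_center_exponent [set: R]%G 2 isT Z2 (subsetT _).
have {Em} : (2 ^ m = 6 + 2 * k)%N.
  by apply/eqP; rewrite -(eqn_pmul2r z_gt0) -Em cardsT cardR.
have [k1 _|k1 Em] := eqVneq k 1%N.
  right; rewrite cardR k1; split=> //; rewrite card_commuting_pairs cardR k1.
  (* In units of |Z|^2, a summand is 1 * 2 or 3 * 4, that is 2 + 10 * [b A]; the total is 8 + 5 * 2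
     + 10 = 28. *)
  rewrite (eq_bigr (fun A => 2 * #|Z| ^ 2 + 10 * #|Z| ^ 2 * b A)%N).
    by rewrite big_split /= sum_nat_const -big_distrr /= card_proper_centralizers -/k k1; lia.
  by move=> A /cardK ->; case: (b A); rewrite expnS expn1; nia.
(* As k is at most 5 and differs from 1, the only power of 2 of the form 6 + 2k is 16. *)
left; rewrite cardR; congr muln.
have [m5|m4] := ltnP 4 m; first by have := leq_pexp2l (isT : (0 < 2)%N) m5; rewrite Em; lia.
by move: Em; case: m m4 => [|[|[|[|[|]]]]] // _; rewrite ?expnS ?expn0; lia.
Qed.

End Commutators.

(** * Elementary abelian groups and the commuting probability *)

Lemma abelem_prodT (gT hT : finGroupType) p :
  prime p -> (p.-abelem [set: gT])%g -> (p.-abelem [set: hT])%g ->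
  (p.-abelem [set: gT * hT])%g.
Proof.
move=> p_pr /abelemP-/(_ p_pr)[/centsP cG expG] /abelemP-/(_ p_pr)[/centsP cH expH].
have expgE (x : gT * hT) n : (x ^+ n = (x.1 ^+ n, x.2 ^+ n))%g.
  by elim: n => // n IHn; rewrite !expgS IHn.
apply/abelemP => //; split=> [|x _]; last by rewrite expgE expG ?expH ?inE.
apply/centsP => -[x1 x2] _ [y1 y2] _.
by congr pair; [apply: cG | apply: cH]; rewrite inE.
Qed.

Lemma abelem_Z2 : (2.-abelem [set: 'Z_2])%g.
Proof.
apply/abelemP => //; split; first exact: FinRing.zmod_abelian.
by move=> x _; rewrite FinRing.zmodXgE; apply/val_inj; case: x => [[|[|]]].
Qed.

Theorem theorem3p4 (R : finRngType) :
  n_centralizer R 6 ->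
  ~~ ([set: R] / rng_center R \isog [set: 'Z_2 * 'Z_2 * 'Z_4])%g ->
  ~~ ([set: R] / rng_center R \isog [set: 'Z_2 * 'Z_2 * 'Z_2 * 'Z_2])%g ->
  (commuting_pr R \in [:: 7 / 16; 35 / 72; 29 / 64])%R.
Proof.
move=> R6 _ notZ2_4.
have z_gt0 : 0 < #|rng_center R| by apply: cardG_gt0.
have [p [->|->] pZ] := center_exponent R6; last by case: (card_rng_exponent3 R6).
case: (card_rng_exponent2 R6 pZ) => [R16 | [R8 pairs28]].
  case/negP: notZ2_4.
  (* Elementary abelian 2-groups of equal order, here 16, are isomorphic. *)
  have abelemZ2_4 : (2.-abelem [set: 'Z_2 * 'Z_2 * 'Z_2 * 'Z_2])%g.
    by rewrite !abelem_prodT ?abelem_Z2.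
  rewrite (isog_abelem_card _ (@quotient_center_abelem _ [set: R]%G 2 _ pZ)) // abelemZ2_4 /=.
  rewrite [in X in X == _]cardsT !card_prod !card_ord -(eqn_pmul2r z_gt0).
  by rewrite -(@card_quotient_center _ [set: R]%G) ?subsetT //= cardsT R16.
rewrite /commuting_pr pairs28 R8 inE; apply/orP; left; apply/eqP.
have : ((#|rng_center R|%:R : rat) != 0)%R by rewrite pnatr_eq0 -lt0n.
by rewrite !natrM => z_neq0; field.
Qed.
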